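(* Let $p$ be a propositional atom. Let $(T^-_{KP})_0$ be the smallest closed theory containing $\mathbf{V}$, $\mathbf{K}$, and the formula $p\leftrightarrow\mathrm{K}\neg p$, and let $T^-_{KP}=(T^-_{KP})_0\cup\mathbf{T}$. Then $T^-_{KP}$ is consistent.
   Context: Fix a nonempty set of symbols called propositional atoms and a symbol $\mathrm{K}$ which is not a propositional atom. Formulas are defined recursively: every propositional atom is a formula; if $\varphi,\psi$ are formulas then so are $\neg\varphi$, $(\varphi\wedge\psi)$, $(\varphi\vee\psi)$, $(\varphi\rightarrow\psi)$; if $\varphi$ is a formula then so is $\mathrm{K}(\varphi)$. $\varphi\leftrightarrow\psi$ abbreviates $(\varphi\rightarrow\psi)\wedge(\psi\rightarrow\varphi)$. A formula is basic if it is a propositional atom or of the form $\mathrm{K}\varphi$. A theory is a set of formulas. A model is a function assigning a truth value to every basic formula; truth $\mathscr M\models\varphi$ of an arbitrary formula is defined from the values of basic formulas by the classical truth tables (formulas $\mathrm{K}\varphi$ are treated like atoms). $\mathscr M\models T$ means $\mathscr M\models\varphi$ for all $\varphi\in T$; $T\models\varphi$ means every model of $T$ satisfies $\varphi$; $\varphi$ is valid if $\emptyset\models\varphi$; $T$ is consistent if some model satisfies $T$. A theory $T$ is closed if $\varphi\in T$ implies $\mathrm{K}\varphi\in T$. $\mathbf{V}=\{\mathrm{K}\varphi:\varphi\text{ valid}\}$; $\mathbf{K}=\{\mathrm{K}(\varphi\rightarrow\psi)\rightarrow(\mathrm{K}\varphi\rightarrow\mathrm{K}\psi)\}$; $\mathbf{T}=\{\mathrm{K}\varphi\rightarrow\varphi\}$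 (all formulas of these forms). *)

(* Defs.v *)
From Stdlib Require Export Bool Ensembles.

Set Implicit Arguments.

Inductive formula (atom : Type) : Type :=
| Atom : atom -> formula atom
| Neg : formula atom -> formula atom
| And : formula atom -> formula atom -> formula atom
| Or : formula atom -> formula atom -> formula atom
| Imp : formula atom -> formula atom -> formula atom
| Know : formula atom -> formula atom.

Definition Iff (atom : Type) (phi psi : formula atom) : formula atom :=
  And (Imp phi psi) (Imp psi phi).

Definition basic (atom : Type) (phi : formula atom) : bool :=
  match phi with
  | Atom _ | Know _ => true
  | _ => false
  end.

(* [Is_true b] computes to [True] or [False], so the proof component of a basic
   formula is unique and [I] inhabits it for atoms and formulas [Know phi]. *)
Definition basic_formula (atom : Type) : Type :=
  {phi : formula atom | Is_true (basic phi)}.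

Definition basic_atom (atom : Type) (a : atom) : basic_formula atom :=
  exist (fun phi => Is_true (basic phi)) (Atom a) I.

Definition basic_know (atom : Type) (phi : formula atom) : basic_formula atom :=
  exist (fun phi => Is_true (basic phi)) (Know phi) I.

Definition model (atom : Type) : Type := basic_formula atom -> bool.

(* There is no recursive call under [Know]: its value is supplied by the model. *)
Fixpoint truth (atom : Type) (M : model atom) (phi : formula atom) : bool :=
  match phi with
  | Atom a => M (basic_atom a)
  | Neg psi => negb (truth M psi)
  | And psi chi => truth M psi && truth M chi
  | Or psi chi => truth M psi || truth M chi
  | Imp psi chi => implb (truth M psi) (truth M chi)
  | Know psi => M (basic_know psi)
  end.

Definition satisfies (atom : Type) (M : model atom) (phi : formula atom) : Prop :=
  truth M phi = true.

Definition theory (atom : Type) : Type := Ensemble (formula atom).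

Definition satisfies_theory (atom : Type) (M : model atom) (T : theory atom) : Prop :=
  forall phi : formula atom, In _ T phi -> satisfies M phi.

Definition entails (atom : Type) (T : theory atom) (phi : formula atom) : Prop :=
  forall M : model atom, satisfies_theory M T -> satisfies M phi.

Definition valid (atom : Type) (phi : formula atom) : Prop :=
  entails (Empty_set _) phi.

Definition consistent (atom : Type) (T : theory atom) : Prop :=
  exists M : model atom, satisfies_theory M T.

Definition closed (atom : Type) (T : theory atom) : Prop :=
  forall phi : formula atom, In _ T phi -> In _ T (Know phi).

Definition schema_V (atom : Type) : theory atom :=
  fun chi => exists phi : formula atom, valid phi /\ chi = Know phi.

Definition schema_K (atom : Type) : theory atom :=
  fun chi => exists phi psi : formula atom,
    chi = Imp (Know (Imp phi psi)) (Imp (Know phi) (Know psi)).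

Definition schema_T (atom : Type) : theory atom :=
  fun chi => exists phi : formula atom, chi = Imp (Know phi) phi.

(* Closedness is preserved by intersections, so this intersection is itself closed. *)
Definition smallest_closed (atom : Type) (S : theory atom) : theory atom :=
  fun phi => forall T : theory atom, closed T -> Included _ S T -> In _ T phi.

Definition T_KP_minus_0 (atom : Type) (p : atom) : theory atom :=
  smallest_closed
    (Union _ (Union _ (schema_V (atom := atom)) (schema_K (atom := atom)))
      (Singleton _ (Iff (Atom p) (Know (Neg (Atom p)))))).

Definition T_KP_minus (atom : Type) (p : atom) : theory atom :=
  Union _ (T_KP_minus_0 p) (schema_T (atom := atom)).

(* Main.v *)
(** Interpret [Know phi] as entailment of [phi] by [T_KP_minus_0 p], and make every
    atom false.  This interpretation satisfies the closure of any axioms it satisfies,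
    and then factivity is automatic: what is entailed by a theory holds in its models.
    The fixed-point axiom holds because both sides are false: the model making
    all basic formulas true satisfies [T_KP_minus_0 p] and [p], so [Neg p] is not
    entailed. *)

Require Import Defs.
From Stdlib Require Import ClassicalEpsilon.

Lemma smallest_closed_Know {atom : Type} (S : theory atom) (phi : formula atom) :
  In _ (smallest_closed S) phi -> In _ (smallest_closed S) (Know phi).
Proof.
  intros Hphi T HT HS. apply HT, Hphi; assumption.
Qed.

Lemma satisfies_smallest_closed {atom : Type} (S : theory atom) (M : model atom) :
  satisfies_theory M S ->
  (forall phi, In _ (smallest_closed S) phi -> satisfies M (Know phi)) ->
  satisfies_theory M (smallest_closed S).
Proof.
  intros HS HK phi Hphi.
  (* Membership is kept in the invariant so that [HK] applies in the closure step. *)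
  apply (Hphi (fun chi => In _ (smallest_closed S) chi /\ satisfies M chi)).
  - intros chi [Hchi _]. split.
    + apply smallest_closed_Know, Hchi.
    + apply HK, Hchi.
  - intros chi Hchi. split.
    + intros T _ HT. apply HT, Hchi.
    + apply HS, Hchi.
Qed.

Definition all_true (atom : Type) : model atom := fun _ => true.

(** In [all_true], formulas [Know phi] hold outright, implications ending in one hold too, and both
    sides of the fixed-point axiom are true. *)
Lemma all_true_T_KP_minus_0 {atom : Type} (p : atom) :
  satisfies_theory (all_true atom) (T_KP_minus_0 p).
Proof.
  apply satisfies_smallest_closed; [| reflexivity].
  intros _ [_ [_ [phi [_ ->]] | _ [phi [psi ->]]] | _ []]; reflexivity.
Qed.

(** Models are boolean-valued while entailment is a proposition, hence the informative excluded
    middle. *)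
Definition entailment_model {atom : Type} (T : theory atom) : model atom :=
  fun b => match proj1_sig b with
           | Know phi => if excluded_middle_informative (entails T phi) then true else false
           | _ => false
           end.

Lemma entailment_model_Know {atom : Type} (T : theory atom) (phi : formula atom) :
  satisfies (entailment_model T) (Know phi) <-> entails T phi.
Proof.
  unfold satisfies; simpl; unfold entailment_model; simpl.
  destruct (excluded_middle_informative (entails T phi)); split; easy.
Qed.

(** The formulas entailed by any theory are closed under modus ponens. *)
Lemma entailment_model_K {atom : Type} (T : theory atom) :
  satisfies_theory (entailment_model T) (schema_K (atom := atom)).
Proof.
  intros _ [phi [psi ->]]. apply implb_true_iff. intros Himp.
  apply implb_true_iff. intros Hphi.
  apply entailment_model_Know in Himp, Hphi. apply entailment_model_Know.
  intros M HM. exact (proj1 (implb_true_iff _ _) (Himp M HM) (Hphi M HM)).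
Qed.

Lemma entailment_model_T {atom : Type} (T : theory atom) :
  satisfies_theory (entailment_model T) T ->
  satisfies_theory (entailment_model T) (schema_T (atom := atom)).
Proof.
  intros HT _ [phi ->]. apply implb_true_iff. intros Hphi.
  apply entailment_model_Know in Hphi. exact (Hphi _ HT).
Qed.

Lemma entailment_model_T_KP_minus_0 {atom : Type} (p : atom) :
  satisfies_theory (entailment_model (T_KP_minus_0 p)) (T_KP_minus_0 p).
Proof.
  apply satisfies_smallest_closed.
  - intros _ [_ [_ [phi [Hphi ->]] | chi Hchi] | _ []].
    (* Validity is entailment by the empty theory, which every model satisfies. *)
    + apply entailment_model_Know. intros M _. apply Hphi. intros _ [].
    + apply entailment_model_K, Hchi.
    + assert (Hp : ~ satisfies (entailment_model (T_KP_minus_0 p)) (Know (Neg (Atom p)))).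
      { intros H. apply entailment_model_Know in H.
        discriminate (H _ (all_true_T_KP_minus_0 p)). }
      apply not_true_is_false in Hp. simpl in Hp.
      unfold satisfies. simpl. rewrite Hp. reflexivity.
  (* A theory entails each of its members. *)
  - intros phi Hphi. apply entailment_model_Know. intros M HM. apply HM, Hphi.
Qed.

Theorem theorem11 (atom : Type) (p : atom) : consistent (T_KP_minus p).
Proof.
  exists (entailment_model (T_KP_minus_0 p)).
  intros _ [phi Hphi | phi Hphi].
  - apply entailment_model_T_KP_minus_0, Hphi.
  - apply entailment_model_T; [apply entailment_model_T_KP_minus_0 | exact Hphi].
Qed.
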